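(* Let $\mathcal M$ be a weakly o-minimal non-valuational expansion of an ordered group. Then $\mathcal M$ is o-minimal if and only if $\mathcal M$ has no external limits and, after naming a non-zero constant, $\mathcal M$ admits definable Skolem functions.
   Context: ''Definable'' means definable with parameters unless specified otherwise. A structure $\mathcal M=\langle M,<,\dots\rangle$ is weakly o-minimal if $<$ is a dense linear order and every definable subset of $M$ is a finite union of convex sets. A weakly o-minimal expansion of an ordered group is non-valuational if it has no definable convex subgroup that is non-trivial and proper. A weakly o-minimal structure $\mathcal M$ has no external limits if for every definable $f:(a,b)\to M$, where $a,b\in M\cup\{\pm\infty\}$, the limits $\lim_{t\to a^+}f(t)$ and $\lim_{t\to b^-}f(t)$ exist in $M\cup\{\pm\infty\}$. $\mathcal M$ admits (has) definable Skolem functions if for every formula $\varphi(\bar x,\bar y)$ of its language there is a $\emptyset$-definable function $f$ such that $\mathcal M\models\forall\bar x\,(\exists\bar y\,\varphi(\bar x,\bar y)\to\varphi(\bar x,f(\bar x)))$. *)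

(* Defs.v *)
From HB Require Import structures.
From mathcomp Require Import all_boot all_order interval.
From mathcomp Require Import boolp classical_sets.

Set Implicit Arguments.
Unset Strict Implicit.
Unset Printing Implicit Defensive.

Import Order.TTheory.
Local Open Scope classical_set_scope.
Local Open Scope order_scope.

(* Groups are not assumed commutative, hence the multiplicative notation:
   [1%g] is the neutral element, i.e. the "zero" of an additive group. *)
HB.mixin Record isOrderedGroup (d : Order.disp_t) G
    of Group G & Order.Total d G := {
  ltg_mul2l : forall x y z : G, y < z -> (x * y)%g < (x * z)%g;
  ltg_mul2r : forall x y z : G, y < z -> (y * x)%g < (z * x)%g
}.

#[short(type="orderedGroupType")]
HB.structure Definition OrderedGroup (d : Order.disp_t) :=
  {G of Group G & Order.Total d G & isOrderedGroup d G}.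

Record language := Language {
  fun_symb : Type;
  fun_arity : fun_symb -> nat;
  rel_symb : Type;
  rel_arity : rel_symb -> nat
}.

Record structure (L : language) (M : Type) := Structure {
  fun_interp : forall f : fun_symb L, (fun_arity f).-tuple M -> M;
  rel_interp : forall r : rel_symb L, (rel_arity r).-tuple M -> Prop
}.

Inductive term (L : language) (n : nat) :=
| Var of 'I_n
| App (f : fun_symb L) of ('I_(fun_arity f) -> term L n).

(* The free variables of a [formula L n] are indexed by ['I_n]; in [Ex phi] the
   bound variable is variable 0 of [phi]. *)
Inductive formula (L : language) : nat -> Type :=
| Eq n of term L n & term L n : formula L n
| Rel n (r : rel_symb L) of ('I_(rel_arity r) -> term L n) : formula L n
| Not n of formula L n : formula L n
| And n of formula L n & formula L n : formula L n
| Ex n of formula L n.+1 : formula L n.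

Section Semantics.
Variables (L : language) (M : Type) (S : structure L M).

Fixpoint eval n (v : n.-tuple M) (t : term L n) : M :=
  match t with
  | Var i => tnth v i
  | App f ts => fun_interp S [tuple eval v (ts i) | i < fun_arity f]
  end.

Fixpoint sat n (phi : formula L n) : n.-tuple M -> Prop :=
  match phi in formula _ k return k.-tuple M -> Prop with
  | Eq _ t u => fun v => eval v t = eval v u
  | Rel _ r ts => fun v => rel_interp S [tuple eval v (ts i) | i < rel_arity r]
  | Not _ p => fun v => ~ sat p v
  | And _ p q => fun v => sat p v /\ sat q v
  | Ex _ p => fun v => exists x : M, sat p (cons_tuple x v)
  end.

(* The tuple [a] is the tuple of parameters. *)
Definition definable n (X : set (n.-tuple M)) : Prop :=
  exists k (a : k.-tuple M) (phi : formula L (n + k)),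
    X = [set x | sat phi (cat_tuple x a)].

Definition definable1 (X : set M) : Prop :=
  definable [set p : 1.-tuple M | X (tnth p ord0)].

Definition definable0_fun m n (f : m.-tuple M -> n.-tuple M) : Prop :=
  exists phi : formula L (m + n),
    forall x y, sat phi (cat_tuple x y) <-> y = f x.

Definition has_definable_Skolem_functions : Prop :=
  forall m n (phi : formula L (m + n)),
    exists2 f : m.-tuple M -> n.-tuple M, definable0_fun f &
      forall x, (exists y, sat phi (cat_tuple x y)) ->
                sat phi (cat_tuple x (f x)).

End Semantics.

Definition sum_language (L1 L2 : language) : language :=
  {| fun_symb := fun_symb L1 + fun_symb L2;
     fun_arity f := match f with inl f1 => fun_arity f1
                               | inr f2 => fun_arity f2 end;
     rel_symb := rel_symb L1 + rel_symb L2;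
     rel_arity r := match r with inl r1 => rel_arity r1
                               | inr r2 => rel_arity r2 end |}.

Definition sum_structure (L1 L2 : language) (M : Type)
    (S1 : structure L1 M) (S2 : structure L2 M) :
    structure (sum_language L1 L2) M :=
  @Structure (sum_language L1 L2) M
    (fun f => match f with inl f1 => @fun_interp _ _ S1 f1
                         | inr f2 => @fun_interp _ _ S2 f2 end)
    (fun r => match r with inl r1 => @rel_interp _ _ S1 r1
                         | inr r2 => @rel_interp _ _ S2 r2 end).

Definition const_language : language :=
  {| fun_symb := unit; fun_arity _ := 0;
     rel_symb := void; rel_arity _ := 0 |}.

Definition const_structure (M : Type) (c : M) : structure const_language M :=
  @Structure const_language M (fun _ _ => c) (fun _ _ => False).

Definition name_constant (L : language) (M : Type) (S : structure L M) (c : M) :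
    structure (sum_language L const_language) M :=
  sum_structure S (const_structure c).

Variant ogroup_fun := OGone | OGinv | OGmul.

Definition ogroup_language : language :=
  {| fun_symb := ogroup_fun;
     fun_arity f := match f with OGone => 0 | OGinv => 1 | OGmul => 2 end;
     rel_symb := unit; rel_arity _ := 2 |}.

Definition ogroup_structure (d : Order.disp_t) (G : orderedGroupType d) :
    structure ogroup_language G :=
  @Structure ogroup_language G
    (fun f => match f return (fun_arity (l := ogroup_language) f).-tuple G -> G
              with
              | OGone => fun _ => 1%g
              | OGinv => fun x => (tnth x ord0)^-1%g
              | OGmul => fun x => (tnth x ord0 * tnth x ord_max)%g
              end)
    (fun _ (x : 2.-tuple G) => (tnth x ord0 < tnth x ord_max) : Prop).

(* An arbitrary expansion of the ordered group [G]: the language of ordered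
   groups together with the symbols of [L], interpreted by [S]. *)
Definition ogroup_expansion (L : language) (d : Order.disp_t)
    (G : orderedGroupType d) (S : structure L G) :
    structure (sum_language ogroup_language L) G :=
  sum_structure (ogroup_structure G) S.

Section Ominimality.
Variables (d : Order.disp_t) (M : orderType d).

Definition dense_order : Prop :=
  forall x y : M, x < y -> exists z : M, x < z < y.

Definition order_convex (C : set M) : Prop :=
  forall x y z, C x -> C z -> x < y < z -> C y.

Variant endpoint := NInfty | Fin of M | PInfty.

Definition lt_endpoint (a b : endpoint) : bool :=
  match a, b with
  | NInfty, NInfty => false
  | NInfty, _ => true
  | Fin x, Fin y => x < y
  | Fin _, PInfty => true
  | _, _ => false
  end.

Definition open_itv (a b : endpoint) : set M :=
  [set x | lt_endpoint a (Fin x) /\ lt_endpoint (Fin x) b].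

Definition eventually_right (a b : endpoint) (P : M -> Prop) : Prop :=
  exists2 s, open_itv a b s & forall t, open_itv a (Fin s) t -> P t.

Definition eventually_left (a b : endpoint) (P : M -> Prop) : Prop :=
  exists2 s, open_itv a b s & forall t, open_itv (Fin s) b t -> P t.

(* [f] tends to [l], for the order topology on M together with -oo and +oo,
   along the filter base described by [ev]. *)
Definition tends_to (ev : (M -> Prop) -> Prop) (f : M -> M) (l : endpoint) :=
  (forall u : M, lt_endpoint (Fin u) l -> ev (fun t => u < f t)) /\
  (forall v : M, lt_endpoint l (Fin v) -> ev (fun t => f t < v)).

Variables (L : language) (S : structure L M).

Definition weakly_o_minimal : Prop :=
  dense_order /\
  forall X : set M, definable1 S X ->
    exists n (C : 'I_n -> set M),
      (forall i, order_convex (C i)) /\ X = \bigcup_i C i.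

(* [interval M] has endpoints in M, -oo and +oo, each included or not; in
   particular the points [`[x, x]] are intervals. *)
Definition o_minimal : Prop :=
  dense_order /\
  forall X : set M, definable1 S X ->
    exists n (I : 'I_n -> interval M), X = \bigcup_i [set` I i].

(* A function on (a, b) is represented by a total [f] whose values outside
   (a, b) are irrelevant: only its graph over (a, b) has to be definable. *)
Definition no_external_limits : Prop :=
  forall (a b : endpoint) (f : M -> M), lt_endpoint a b ->
    definable S [set p : 2.-tuple M |
      open_itv a b (tnth p ord0) /\ tnth p ord_max = f (tnth p ord0)] ->
    (exists l, tends_to (eventually_right a b) f l) /\
    (exists l, tends_to (eventually_left a b) f l).

End Ominimality.

Definition is_subgroup (G : groupType) (H : set G) : Prop :=
  H 1%g /\ forall x y, H x -> H y -> H (x / y)%g.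

Definition non_valuational (d : Order.disp_t) (G : orderedGroupType d)
    (L : language) (S : structure L G) : Prop :=
  forall H : set G, definable1 S H -> order_convex H -> is_subgroup H ->
    H = [set 1%g] \/ H = setT.

(* Main.v *)
Require Import Defs.
From mathcomp Require Import all_boot all_order interval.
From mathcomp Require Import boolp classical_sets.

(** Definable completeness -- every nonempty definable set that is bounded
    above has a supremum -- is what links the two sides.

    In a weakly o-minimal structure it is equivalent to o-minimality. The
    supremum of a finite union of intervals is the right endpoint of a cofinal
    one ([o_minimal_complete]); conversely, a definable set is the union of
    finitely many of its convex components, which are definable, hence
    intervals as soon as their infima and suprema exist ([complete_o_minimal]).

    From Skolem functions and limits to completeness ([Skolem_complete]): a
    definable set without supremum yields a definable cut, with lower part [C],
    that no element of the group realizes. The right translations preserving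
    [C] form a proper definable convex subgroup, which is trivial as the
    structure is non-valuational; so for every [t > 1] some [y] in [C] has
    [y * t] outside [C] ([cut_translate]). A Skolem function picks such a
    [y = f t]. When [t] tends to 1 both [f t] and [f t * t] approach the cut,
    from its two sides, so a limit of [f] would realize the cut.

    From completeness to limits ([complete_no_external_limits]): by weak
    o-minimality, near an end of its domain a definable [f] is eventually above
    or eventually not above any given value, and the supremum of the values
    that it eventually exceeds is its limit.

    From completeness to Skolem functions ([complete_Skolem]): it is enough to
    choose one element of a nonempty definable [X], uniformly in the
    parameters. If [X] has a least element this is the choice; otherwise the
    lowest convex component [Y] of [X] is nonempty and has no least element,
    and one of [1], [sup Y / e], [inf Y * e], [inf Y * h] lies in it, where
    [e > 1] is the named constant or its inverse and [h] is the supremum of the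
    [y] with [y * y <= (inf Y)^-1 * sup Y] ([convex_point]). This [h] plays the
    part of one half of [(inf Y)^-1 * sup Y] in a group that is not known to be
    divisible: it lies strictly between [1] and that element
    ([sup_square_between]).

    Definability is handled on infinite assignments [nat -> M], through the
    classes [tdef] and [pdef] of what terms and formulas define. *)

Set Implicit Arguments.
Unset Strict Implicit.
Unset Printing Implicit Defensive.

Import Order.TTheory.
Local Open Scope classical_set_scope.
Local Open Scope order_scope.

(** * Renaming the variables of a formula *)

Section Renaming.
Variables (L : language).

Fixpoint rename_term n m (r : 'I_n -> 'I_m) (t : term L n) : term L m :=
  match t with
  | Var i => @Var L m (r i)
  | App f ts => @App L m f (fun i => rename_term r (ts i))
  end.

Definition lift_renaming n m (r : 'I_n -> 'I_m) (i : 'I_n.+1) : 'I_m.+1 :=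
  if unlift ord0 i is Some j then lift ord0 (r j) else ord0.

Fixpoint rename n (phi : formula L n) : forall m, ('I_n -> 'I_m) -> formula L m :=
  match phi in formula _ k return forall m, ('I_k -> 'I_m) -> formula L m with
  | Eq _ t u => fun m r => Eq (rename_term r t) (rename_term r u)
  | Rel _ R ts => fun m r => Rel (fun i => rename_term r (ts i))
  | Not _ p => fun m r => Not (rename p r)
  | And _ p q => fun m r => And (rename p r) (rename q r)
  | Ex _ p => fun m r => Ex (rename p (lift_renaming r))
  end.

Variables (M : Type) (S : structure L M).

Lemma eval_rename n m (r : 'I_n -> 'I_m) (v : m.-tuple M) (t : term L n) :
  eval S v (rename_term r t) = eval S [tuple tnth v (r i) | i < n] t.
Proof.
elim: t => [i|f ts IH] /=; first by rewrite tnth_mktuple.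
by congr fun_interp; apply: eq_from_tnth => i; rewrite !tnth_mktuple IH.
Qed.

Lemma sat_rename n (phi : formula L n) m (r : 'I_n -> 'I_m) (v : m.-tuple M) :
  sat S (rename phi r) v <-> sat S phi [tuple tnth v (r i) | i < n].
Proof.
elim: phi m r v => {n} [n t u|n R ts|n p IH|n p IHp q IHq|n p IH] m r v /=.
- by rewrite !eval_rename.
- suff -> : [tuple eval S v (rename_term r (ts i)) | i < rel_arity R] =
    [tuple eval S [tuple tnth v (r i) | i < n] (ts i) | i < rel_arity R] by [].
  by apply: eq_from_tnth => i; rewrite !tnth_mktuple eval_rename.
- by rewrite IH.
- by rewrite IHp IHq.
have E x : [tuple tnth (cons_tuple x v) (lift_renaming r i) | i < n.+1] =
    cons_tuple x [tuple tnth v (r i) | i < n].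
  apply: eq_from_tnth => i; rewrite tnth_mktuple /lift_renaming.
  by case: unliftP => [j ->|->]; rewrite ?tnthS ?tnth_mktuple ?tnth0.
by split=> -[x Hx]; exists x; move: Hx; rewrite IH E.
Qed.

End Renaming.

(** * Definability over assignments *)

Definition scons (M : Type) (x : M) (v : nat -> M) : nat -> M :=
  fun i => if i is j.+1 then v j else x.
Notation "x .: v" := (scons x v) (at level 55, right associativity).

Lemma scons_eta (M : Type) (v : nat -> M) : v 0 .: (fun i => v i.+1) = v.
Proof. by apply/funext => -[|i]. Qed.

Notation "s ++: v" := (foldr (@scons _) v s) (at level 55, right associativity).

Lemma catvE (M : Type) (x0 : M) (s : seq M) v i :
  (s ++: v) i = if (i < size s)%N then nth x0 s i else v (i - size s)%N.
Proof. by elim: s i => [|x s IH] [|i] //=; rewrite IH. Qed.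

Lemma catv_mktuple (M : Type) n (v : nat -> M) :
  [tuple v i | i < n] ++: (fun i => v (n + i)%N) = v.
Proof.
apply/funext => i; rewrite (catvE (v 0)) size_tuple.
case: ltnP => [ni|/subnKC -> //].
by rewrite -[i]/(nat_of_ord (Ordinal ni)) -tnth_nth tnth_mktuple.
Qed.

(** The functions and predicates on assignments given by terms and formulas
    with parameters in [A]. As classes of functions, they make the closure
    under substitution and the changes of language below inductions on the
    class, with no bookkeeping of arities; [pdef_sat] and [pdef_syntax] go back
    and forth between formulas and this class. *)
Section ValuationDefinability.
Variables (L : language) (M : Type) (S : structure L M).

Section Classes.
Variable (A : set M).

Inductive tdef : ((nat -> M) -> M) -> Prop :=
| tdef_var i : tdef (fun v => v i)
| tdef_const a : A a -> tdef (fun=> a)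
| tdef_app f (ts : 'I_(fun_arity f) -> (nat -> M) -> M) :
    (forall i, tdef (ts i)) ->
    tdef (fun v => fun_interp S [tuple ts i v | i < fun_arity f]).

Inductive pdef : ((nat -> M) -> Prop) -> Prop :=
| pdef_eq t u : tdef t -> tdef u -> pdef (fun v => t v = u v)
| pdef_rel r (ts : 'I_(rel_arity r) -> (nat -> M) -> M) :
    (forall i, tdef (ts i)) ->
    pdef (fun v => rel_interp S [tuple ts i v | i < rel_arity r])
| pdef_not P : pdef P -> pdef (fun v => ~ P v)
| pdef_and P Q : pdef P -> pdef Q -> pdef (fun v => P v /\ Q v)
| pdef_ex1 P : pdef P -> pdef (fun v => exists x, P (x .: v)).

Lemma pdef_ext P Q : (forall v, P v <-> Q v) -> pdef P -> pdef Q.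
Proof. by move=> PQ; rewrite (_ : P = Q) //; apply/funext => v; exact/propext. Qed.

Lemma pdef_ex (P : M -> (nat -> M) -> Prop) :
  pdef (fun v => P (v 0) (fun i => v i.+1)) -> pdef (fun v => exists x, P x v).
Proof. exact: pdef_ex1. Qed.

Lemma pdef_imp P Q : pdef P -> pdef Q -> pdef (fun v => P v -> Q v).
Proof.
move=> dP dQ; apply: (@pdef_ext (fun v => ~ (P v /\ ~ Q v))) => [v|].
  by split=> [nPQ Pv|PQ [Pv]]; [apply: contrapT => nQ; exact: nPQ|apply; exact: PQ].
by apply/pdef_not/pdef_and => //; exact: pdef_not.
Qed.

Lemma pdef_or P Q : pdef P -> pdef Q -> pdef (fun v => P v \/ Q v).
Proof.
move=> dP dQ; apply: (@pdef_ext (fun v => ~ P v -> Q v)) => [v|].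
  split=> [|[Pv nPv|//]]; last by case: nPv.
  by case: (pselect (P v)) => [|nP /(_ nP)]; [left|right].
by apply: pdef_imp => //; exact: pdef_not.
Qed.

Lemma pdef_all (P : M -> (nat -> M) -> Prop) :
  pdef (fun v => P (v 0) (fun i => v i.+1)) -> pdef (fun v => forall x, P x v).
Proof.
move=> dP; apply: (@pdef_ext (fun v => ~ exists x, ~ P x v)) => [v|].
  by split=> [nP x|allP [x]]; [apply: contrapT => nPx; apply: nP; exists x|exact].
by apply/pdef_not/pdef_ex/pdef_not.
Qed.

Lemma tdef_subst s t : (forall i, tdef (s i)) -> tdef t ->
  tdef (fun v => t (fun i => s i v)).
Proof.
move=> ds; elim=> [i|a Aa|f ts _ IH]; [exact: ds|exact: tdef_const|exact: tdef_app].
Qed.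

Lemma tdef_shift t : tdef t -> tdef (fun v => t (fun i => v i.+1)).
Proof. by apply: tdef_subst => i; exact: tdef_var. Qed.

Lemma pdef_subst s P : (forall i, tdef (s i)) -> pdef P ->
  pdef (fun v => P (fun i => s i v)).
Proof.
move=> ds dP; elim: dP s ds => {P} [t u dt du|r ts dts|P _ IH|P Q _ IHP _ IHQ|P _ IH] s ds.
- by apply: pdef_eq; exact: tdef_subst.
- by apply: pdef_rel => i; apply: tdef_subst.
- exact/pdef_not/IH.
- by apply: pdef_and; [exact: IHP|exact: IHQ].
apply: pdef_ex.
have /IH : forall i, tdef (fun v => (v 0%N .: (fun i => s i (fun j => v j.+1))) i).
  by case=> [|i] /=; [exact: tdef_var|exact: tdef_shift].
by apply: pdef_ext => v; rewrite (_ : (fun i => _) = v 0 .: (fun i => s i (fun j => v j.+1))).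
Qed.

Lemma tdef_eval n (t : term L n) s : (forall i, tdef (s i)) ->
  tdef (fun v => eval S [tuple s i v | i < n] t).
Proof.
move=> ds; elim: t => [i|f ts IH] /=; last exact: tdef_app.
by rewrite (_ : (fun v => _) = s i)//; apply/funext => v; rewrite tnth_mktuple.
Qed.

Lemma pdef_sat n (phi : formula L n) s : (forall i, tdef (s i)) ->
  pdef (fun v => sat S phi [tuple s i v | i < n]).
Proof.
elim: phi s => {n} [n t u|n R ts|n p IH|n p IHp q IHq|n p IH] s ds /=.
- by apply: pdef_eq; exact: tdef_eval.
- by apply: pdef_rel => i; exact: tdef_eval.
- exact/pdef_not/IH.
- by apply: pdef_and; [exact: IHp|exact: IHq].
apply: pdef_ex.
pose s' (i : 'I_n.+1) v := if unlift ord0 i is Some j then s j (fun k => v k.+1) else v 0.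
have /IH : forall i, tdef (s' i).
  rewrite /s' => i; case: unlift => [j|]; last exact: tdef_var.
  exact: tdef_shift.
apply: pdef_ext => v.
rewrite (_ : cons_tuple _ _ = [tuple s' i v | i < n.+1]) //.
apply: eq_from_tnth => i; rewrite tnth_mktuple /s'.
by case: unliftP => [j ->|->]; rewrite ?tnthS ?tnth_mktuple ?tnth0.
Qed.

(** A free variable of a formula is seen as a slot, to be filled either with a
    parameter or with a variable of the assignment. *)
Definition read (v : nat -> M) (x : M + nat) : M :=
  match x with inl a => a | inr j => v j end.

Definition params_in n (r : 'I_n -> M + nat) : Prop :=
  forall i a, r i = inl a -> A a.

(** The numbers of slots of the given terms are unrelated: the slots of the
    common terms are the elements of the disjoint union. *)
Lemma merge_terms k (ts : 'I_k -> (nat -> M) -> M) :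
  (forall i, exists n (u : term L n) (r : 'I_n -> M + nat), params_in r /\
     forall v, ts i v = eval S [tuple read v (r j) | j < n] u) ->
  exists n (us : 'I_k -> term L n) (r : 'I_n -> M + nat), params_in r /\
    forall i v, ts i v = eval S [tuple read v (r j) | j < n] (us i).
Proof.
move=> H; pose X := {n : nat & (term L n * ('I_n -> M + nat))%type}.
have /choice[g gP] : forall i, exists p : X, params_in (tagged p).2 /\
    forall v, ts i v = eval S [tuple read v ((tagged p).2 j) | j < tag p] (tagged p).1.
  by move=> i; have [n [u [r ?]]] := H i; exists (existT _ n (u, r)).
pose I : finType := {i : 'I_k & 'I_(tag (g i))}.
pose rk i (j : 'I_(tag (g i))) : 'I_#|I| := enum_rank (Tagged (fun i => 'I_(tag (g i))) j : I).
pose r (x : 'I_#|I|) := (tagged (g (tag (enum_val x)))).2 (tagged (enum_val x)).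
exists #|I|, (fun i => rename_term (rk i) (tagged (g i)).1), r; split.
  by move=> x a; apply: (gP _).1.
move=> i v; rewrite (gP i).2 eval_rename; congr eval.
by apply: eq_from_tnth => j; rewrite !tnth_mktuple /r /rk enum_rankK.
Qed.

Lemma tdef_syntax t : tdef t ->
  exists n (u : term L n) (r : 'I_n -> M + nat), params_in r /\
    forall v, t v = eval S [tuple read v (r i) | i < n] u.
Proof.
elim=> [i|a Aa|f ts _ /merge_terms[n [us [r [rA E]]]]].
- exists 1, (@Var L 1 ord0), (fun=> inr i); split=> // v.
  by rewrite /= tnth_mktuple.
- exists 1, (@Var L 1 ord0), (fun=> inl a); split=> [_ _ [<-]//|v].
  by rewrite /= tnth_mktuple.
exists n, (@App L n f us), r; split=> // v /=.
by congr fun_interp; apply: eq_from_tnth => i; rewrite !tnth_mktuple E.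
Qed.

Lemma pdef_syntax P : pdef P ->
  exists n (phi : formula L n) (r : 'I_n -> M + nat), params_in r /\
    forall v, P v <-> sat S phi [tuple read v (r i) | i < n].
Proof.
elim=> {P} [t u dt du|R ts dts|P _ [n [p [r [rA E]]]]
  |P Q _ [n [p [r [rA E]]]] _ [m [q [s [sA F]]]]|P _ [n [p [r [rA E]]]]].
- have [|n [us [r [rA E]]]] := @merge_terms 2 (fun i => if i == ord0 then t else u).
    by move=> i; case: eqP => _; exact: tdef_syntax.
  exists n, (Eq (us ord0) (us ord_max)), r; split=> // v /=.
  by rewrite -!E.
- have [|n [us [r [rA E]]]] := @merge_terms _ ts.
    by move=> i; exact: tdef_syntax.
  exists n, (Rel us), r; split=> // v /=.
  rewrite (_ : [tuple ts i v | i < _] =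
    [tuple eval S [tuple read v (r i0) | i0 < n] (us i) | i < rel_arity R]) //.
  by apply: eq_from_tnth => i; rewrite !tnth_mktuple E.
- by exists n, (Not p), r; split=> // v /=; rewrite E.
- exists (n + m)%N, (And (rename p (@lshift n m)) (rename q (@rshift n m))),
    (fun i => match split i with inl j => r j | inr j => s j end).
  split=> [i a|v /=].
    by case: split => [j /rA|j /sA].
  rewrite !sat_rename E F; set w : (n + m).-tuple M := mktuple _.
  have -> : [tuple tnth w (lshift m i) | i < n] = [tuple read v (r i) | i < n].
    by apply: eq_from_tnth => i; rewrite !tnth_mktuple (unsplitK (inl i)).
  suff -> : [tuple tnth w (rshift n i) | i < m] = [tuple read v (s i) | i < m] by [].
  by apply: eq_from_tnth => i; rewrite !tnth_mktuple (unsplitK (inr i)).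
(* slots reading the variable 0 become the bound variable *)
pose f (i : 'I_n) : 'I_n.+1 := if r i is inr 0 then ord0 else lift ord0 i.
pose s (i : 'I_n) : M + nat := if r i is inr j then inr j.-1 else r i.
exists n, (Ex (rename p f)), s; split=> [i a|v /=].
  by rewrite /s; case E1: (r i) => [b|//] [<-]; exact: rA E1.
have F x : [tuple tnth (cons_tuple x [tuple read v (s i) | i < n]) (f i) | i < n]
    = [tuple read (x .: v) (r i) | i < n].
  apply: eq_from_tnth => i; rewrite !tnth_mktuple /f /s.
  case E1: (r i) => [b|[|j]]; rewrite ?tnth0 ?tnthS ?tnth_mktuple ?E1 //=.
by split=> -[x Hx]; exists x; move: Hx; rewrite E sat_rename F.
Qed.

End Classes.
End ValuationDefinability.

(** * Definable sets and assignments *)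

Lemma tuple_split (M : Type) n k (f : 'I_(n + k) -> M) x a :
  (forall i, f (lshift k i) = tnth x i) -> (forall i, f (rshift n i) = tnth a i) ->
  [tuple f i | i < n + k] = cat_tuple x a.
Proof.
move=> fx fa; apply: eq_from_tnth => i; rewrite tnth_mktuple.
by rewrite -(splitK i); case: split => j; rewrite /= ?fx ?fa (tnth_lshift, tnth_rshift).
Qed.

Section Bridge.
Variables (L : language) (M : Type) (S : structure L M) (x0 : M).

Definition pad n (x : n.-tuple M) : nat -> M := nth x0 x.

Lemma mktuple_pad n (x : n.-tuple M) : [tuple pad x i | i < n] = x.
Proof. by apply: eq_from_tnth => i; rewrite tnth_mktuple (tnth_nth x0). Qed.

Lemma definableP n (X : set (n.-tuple M)) :
  definable S X <-> pdef S setT (fun v => X [tuple v i | i < n]).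
Proof.
split=> [[k [a [phi ->]]]|].
  pose s (i : 'I_(n + k)) (v : nat -> M) :=
    match split i with inl j => v j | inr j => tnth a j end.
  have /(pdef_sat phi) : forall i, tdef S setT (s i).
    by rewrite /s => i; case: split => j; [exact: tdef_var|exact: tdef_const].
  apply: pdef_ext => v.
  rewrite (@tuple_split _ _ _ _ [tuple v i | i < n] a) //= => i; rewrite /s.
    by rewrite (unsplitK (inl i)) tnth_mktuple.
  by rewrite (unsplitK (inr i)).
case/pdef_syntax => k [phi [r [_ E]]].
pose a : k.-tuple M := [tuple if r i is inl b then b else x0 | i < k].
pose f (i : 'I_k) : 'I_(n + k) :=
  if r i is inr j then if insub j is Some j' then lshift k j' else rshift n i
  else rshift n i.
exists k, a, (rename phi f); apply/funext => x; apply/propext.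
have := E (pad x); rewrite mktuple_pad => ->; rewrite /= sat_rename.
suff -> : [tuple tnth (cat_tuple x a) (f i) | i < k] =
  [tuple read (pad x) (r i) | i < k] by [].
apply: eq_from_tnth => i; rewrite !tnth_mktuple /f.
case E1: (r i) => [b|j] /=; first by rewrite tnth_rshift tnth_mktuple E1.
case: insubP => [j' _ <-|]; first by rewrite tnth_lshift (tnth_nth x0).
rewrite -leqNgt => nj; rewrite tnth_rshift tnth_mktuple E1.
by rewrite /pad nth_default // size_tuple.
Qed.

(** From right to left, the variables of index at least [n] are gathered in a
    single dummy variable, which is then quantified away; this also covers
    [n = 0] in a language without constants. *)
Lemma definable0P n (X : set (n.-tuple M)) :
  (exists phi : formula L n, forall x, sat S phi x <-> X x) <->
  pdef S set0 (fun v => X [tuple v i | i < n]).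
Proof.
split=> [[phi phiX]|].
  have : pdef S set0 (fun v => sat S phi [tuple v i | i < n]).
    by apply: pdef_sat => i; exact: tdef_var.
  by apply: pdef_ext => v; exact: phiX.
case/pdef_syntax => k [phi [r [r0 E]]].
pose f (i : 'I_k) : 'I_n.+1 :=
  if r i is inr j then if insub j is Some j' then lift ord0 j' else ord0
  else ord0.
exists (Ex (rename phi f)) => x /=.
pose v y : nat -> M := nth y x.
have F y : [tuple tnth (cons_tuple y x) (f i) | i < k] =
    [tuple read (v y) (r i) | i < k].
  apply: eq_from_tnth => i; rewrite !tnth_mktuple /f.
  case E1: (r i) => [b|j] /=; first by case: (r0 _ _ E1).
  case: insubP => [j' _ <-|]; first by rewrite tnthS (tnth_nth y).
  by rewrite -leqNgt => nj; rewrite tnth0 /v nth_default // size_tuple.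
have vx y : [tuple v y i | i < n] = x.
  by apply: eq_from_tnth => i; rewrite tnth_mktuple (tnth_nth y).
split=> [[y]|Xx]; first by rewrite sat_rename F -E vx.
by exists x0; rewrite sat_rename F -E vx.
Qed.

Lemma definable1P (X : set M) :
  definable1 S X <-> pdef S setT (fun v => X (v 0)).
Proof.
rewrite /definable1 definableP; set P := (P in pdef _ _ P <-> _).
suff -> : P = (fun v => X (v 0)) by [].
by apply/funext => v; rewrite /P /= tnth_mktuple.
Qed.

Lemma definable2P (X : M -> M -> Prop) :
  definable S [set p : 2.-tuple M | X (tnth p ord0) (tnth p ord_max)] <->
  pdef S setT (fun v => X (v 0) (v 1)).
Proof.
rewrite definableP; set P := (P in pdef _ _ P <-> _).
suff -> : P = (fun v => X (v 0) (v 1)) by [].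
by apply/funext => v; rewrite /P /= !tnth_mktuple.
Qed.

(** The relation may involve parameters whereas Skolem functions are attached to
    formulas without parameters: the parameters are first made arguments of the
    Skolem function, and then fixed. *)
Lemma Skolem_choice (X : M -> M -> Prop) :
  has_definable_Skolem_functions S -> pdef S setT (fun v => X (v 0) (v 1)) ->
  exists2 f : M -> M, pdef S setT (fun v => v 1 = f (v 0)) &
    forall t, (exists y, X t y) -> X t (f t).
Proof.
move=> sk /pdef_syntax[k [phi [r [_ E]]]].
pose a : k.-tuple M := [tuple if r i is inl b then b else x0 | i < k].
pose f (i : 'I_k) : 'I_((1 + k) + 1) :=
  match r i with
  | inl _ => lshift 1 (rshift 1 i)
  | inr 0 => lshift 1 (lshift k ord0)
  | inr _ => rshift (1 + k) ord0
  end.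
have [F [theta thetaP] FP] := sk _ _ (rename phi f).
have satE t y : sat S (rename phi f) (cat_tuple (cat_tuple [tuple t] a) [tuple y])
    <-> X t y.
  rewrite sat_rename; have := E (t .: fun=> y); rewrite /= => ->.
  set w := mktuple _; suff -> : w = [tuple read (t .: fun=> y) (r i) | i < k] by [].
  apply: eq_from_tnth => i; rewrite !tnth_mktuple /f.
  case E1: (r i) => [b|[|j]].
  - by rewrite tnth_lshift tnth_rshift tnth_mktuple E1.
  - by rewrite !tnth_lshift.
  - by rewrite tnth_rshift.
exists (fun t => tnth (F (cat_tuple [tuple t] a)) ord0); last first.
  move=> t [y /satE Xty]; apply/satE.
  have {Xty} /FP : exists z, sat S (rename phi f) (cat_tuple (cat_tuple [tuple t] a) z).
    by exists [tuple y].
  set z := F _; rewrite (_ : [tuple tnth z ord0] = z) //.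
  by apply: eq_from_tnth => i; rewrite (ord1 i).
pose s (i : 'I_((1 + k) + 1)) (v : nat -> M) :=
  match split i with
  | inl j => if split j is inr j' then tnth a j' else v 0
  | inr _ => v 1
  end.
have /(pdef_sat theta) : forall i, tdef S setT (s i).
  rewrite /s => i; case: split => [j|_]; last exact: tdef_var.
  by case: split => [_|j']; [exact: tdef_var|exact: tdef_const].
apply: pdef_ext => v.
rewrite (@tuple_split _ _ _ _ (cat_tuple [tuple v 0] a) [tuple v 1]).
- rewrite thetaP; set z := F _; split=> [<- //|->].
  by apply: eq_from_tnth => i; rewrite (ord1 i).
- move=> i; rewrite /s (unsplitK (inl i)) -{2}(splitK i).
  by case: split => j /=; rewrite (tnth_lshift, tnth_rshift) // (ord1 j).
- by move=> i; rewrite /s (unsplitK (inr i)) (ord1 i).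
Qed.

End Bridge.

(** * Changing the language *)

Section Languages.
Variables (L1 L2 : language) (M : Type).
Variables (S1 : structure L1 M) (S2 : structure L2 M) (A : set M).

Lemma tdef_suml t : tdef S1 A t -> tdef (sum_structure S1 S2) A t.
Proof.
elim=> [i|a Aa|f ts _ IH]; [exact: tdef_var|exact: tdef_const|].
exact: (@tdef_app _ _ (sum_structure S1 S2) A (inl f)).
Qed.

Lemma pdef_suml P : pdef S1 A P -> pdef (sum_structure S1 S2) A P.
Proof.
elim=> {P} [t u dt du|r ts dts|P _ IH|P Q _ IHP _ IHQ|P _ IH].
- by apply: pdef_eq; exact: tdef_suml.
- apply: (@pdef_rel _ _ (sum_structure S1 S2) A (inl r)) => i; exact: tdef_suml.
- exact: pdef_not.
- exact: pdef_and.
- exact: pdef_ex1.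
Qed.

End Languages.

Section NamedConstant.
Variables (L1 : language) (M : Type) (S1 : structure L1 M) (c : M).

Lemma tdef_name_constant t : tdef (name_constant S1 c) setT t -> tdef S1 setT t.
Proof.
elim=> [i|a Aa|[f|[]] ts _ IH]; [exact: tdef_var|exact: tdef_const| |].
  exact: (@tdef_app _ _ S1 setT f).
exact: tdef_const.
Qed.

(** Naming a constant is the same as allowing it as a parameter. *)
Lemma pdef_name_constant P : pdef (name_constant S1 c) setT P <-> pdef S1 setT P.
Proof.
split; last exact: pdef_suml.
elim=> {P} [t u dt du|[r|[]] ts dts|P _ IH|P Q _ IHP _ IHQ|P _ IH].
- by apply: pdef_eq; exact: tdef_name_constant.
- apply: (@pdef_rel _ _ S1 setT r) => i; exact: tdef_name_constant.
- exact: pdef_not.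
- exact: pdef_and.
- exact: pdef_ex1.
Qed.
End NamedConstant.

(** * Suprema and intervals in linear orders *)

Section Order.
Context {d : Order.disp_t} {T : orderType d}.
Implicit Types (K X : set T).

Lemma order_convexW K x y z : order_convex K -> K x -> K z -> x <= y -> y <= z -> K y.
Proof.
move=> cK Kx Kz; rewrite !le_eqVlt => /orP[/eqP <- //|xy] /orP[/eqP -> //|yz].
by apply: (cK x y z) => //; rewrite xy.
Qed.

(** If each part had a strict upper bound in the union, the largest of these
    bounds would belong to no part. *)
Lemma cofinal_part n (C : 'I_n -> set T) (X := \bigcup_i C i) : X !=set0 ->
  exists i, forall x, X x -> exists2 y, C i y & x <= y.
Proof.
move=> [x0 [i0 _ Cx0]]; apply: contrapT => nC.
have /choice[g gP] : forall i, exists x, X x /\ forall y, C i y -> y < x.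
  move=> i; apply: contrapT => nx; apply: nC; exists i => x Xx.
  apply: contrapT => ny; apply: nx; exists x; split=> // y Cy.
  by rewrite ltNge; apply/negP => xy; apply: ny; exists y.
have [i _ gi] := arg_maxP g (isT : xpredT i0).
have [j _ Cj] := (gP i).1.
by have := lt_le_trans ((gP j).2 _ Cj) (gi j isT); rewrite ltxx.
Qed.

Lemma supremumsP X l : supremums X l ->
  (forall x, X x -> x <= l) /\ forall y, y < l -> exists2 x, X x & y < x.
Proof.
move=> [ub lub]; split=> // y yl; apply: contrapT => nx.
have /lub : ubound X y; last by rewrite leNgt yl.
by move=> x Xx; rewrite leNgt; apply/negP => yx; apply: nx; exists x.
Qed.

Lemma infimumsP X l : infimums X l ->
  (forall x, X x -> l <= x) /\ forall y, l < y -> exists2 x, X x & x < y.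
Proof.
move=> [lb glb]; split=> // y yl; apply: contrapT => nx.
have /glb : lbound X y; last by rewrite leNgt yl.
by move=> x Xx; rewrite leNgt; apply/negP => yx; apply: nx; exists x.
Qed.

Lemma supremums_lbound X l : supremums (lbound X) l -> infimums X l.
Proof. by move=> [ub lub]; split=> // x Xx; apply: lub => y; exact. Qed.

Lemma interval_supremums (I : interval T) : dense_order T ->
  (forall x : T, exists y, x < y) ->
  [set` I] !=set0 -> has_ubound [set` I] -> supremums [set` I] !=set0.
Proof.
move=> dT nomax; case: I => l r [x Ix] [u ub].
case: r Ix ub => [b z|[]] Ix ub.
- exists z; split=> [y /=|y yub].
    by rewrite itv_boundlr => /andP[_]; case: b {Ix ub} => // /ltW.
  rewrite leNgt; apply/negP => yz.
  have [w /andP[yw wz]] := dT _ _ yz.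
  have /yub : w \in Interval l (BSide b z); last by rewrite leNgt yw.
  move: (Ix); rewrite /= !itv_boundlr => /andP[lx _].
  rewrite (le_trans lx) /=; last exact: le_trans (yub x Ix) (ltW yw).
  by case: b {Ix ub yub lx} => //=; rewrite ltW.
- by move: Ix; rewrite /= itv_boundlr andbF.
have [w uw] := nomax u.
have /ub : w \in Interval l +oo.
  move: (Ix); rewrite /= !itv_boundlr !andbT => lx.
  by rewrite (le_trans lx) // /Order.le /= (le_trans (ub _ Ix)) ?ltW.
by rewrite leNgt uw.
Qed.

(** On each side the convex set is either unbounded or cut off by its extremum,
    whose membership decides between a closed and an open endpoint. *)
Lemma convex_itv K : order_convex K ->
  (has_ubound K -> supremums K !=set0) -> (has_lbound K -> infimums K !=set0) ->
  K !=set0 -> exists I : interval T, K = [set` I].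
Proof.
move=> cK supK infK [k Kk].
have [r rP] : exists r, forall x, (exists2 y, K y & x <= y) <-> BRight x <= r.
  have [/supK[l lubl]|nub] := pselect (has_ubound K); last first.
    exists +oo => x; split=> // _; apply: contrapT => ny; apply: nub.
    exists x => y Ky; rewrite leNgt; apply/negP => xy.
    by apply: ny; exists y => //; exact: ltW.
  have [ub lub] := supremumsP lubl.
  have [Kl|nKl] := pselect (K l).
    by exists (BRight l) => x; split=> [[y /ub yl xy]|xl];
      [exact: le_trans yl|exists l].
  exists (BLeft l) => x; split=> [[y Ky xy]|/lub[y Ky xy]].
    apply: le_lt_trans xy _; rewrite lt_neqAle ub // andbT.
    by apply/eqP => yl; apply: nKl; rewrite -yl.
  by exists y => //; exact: ltW.
have [l lP] : exists l, forall x, (exists2 y, K y & y <= x) <-> l <= BLeft x.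
  have [/infK[l glbl]|nlb] := pselect (has_lbound K); last first.
    exists -oo => x; split=> // _; apply: contrapT => ny; apply: nlb.
    exists x => y Ky; rewrite leNgt; apply/negP => yx.
    by apply: ny; exists y => //; exact: ltW.
  have [lb glb] := infimumsP glbl.
  have [Kl|nKl] := pselect (K l).
    by exists (BLeft l) => x; split=> [[y /lb ly yx]|lx];
      [exact: le_trans yx|exists l].
  exists (BRight l) => x; split=> [[y Ky yx]|/glb[y Ky yx]].
    apply: lt_le_trans yx; rewrite lt_neqAle lb // andbT.
    by apply/eqP => ly; apply: nKl; rewrite ly.
  by exists y => //; exact: ltW.
exists (Interval l r); apply/seteqP; split=> x; rewrite /= itv_boundlr.
  by move=> Kx; apply/andP; split; [apply/lP|apply/rP]; exists x.
by move=> /andP[/lP[y Ky yx] /rP[z Kz xz]]; exact: order_convexW cK Ky Kz yx xz.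
Qed.

End Order.

(** * Definability in ordered groups *)

Section OrderedGroup.
Context {d : Order.disp_t} {G : orderedGroupType d}.
Implicit Types x y z : G.

Lemma ltg_mul2lE x y z : (x * y < x * z)%g = (y < z).
Proof.
apply/idP/idP => [|/ltg_mul2l//]; apply: contraTT; rewrite -!leNgt le_eqVlt.
by case/predU1P => [->//|/(ltg_mul2l x)/ltW].
Qed.

Lemma ltg_mul2rE x y z : (y * x < z * x)%g = (y < z).
Proof.
apply/idP/idP => [|/ltg_mul2r//]; apply: contraTT; rewrite -!leNgt le_eqVlt.
by case/predU1P => [->//|/(ltg_mul2r x)/ltW].
Qed.

Lemma leg_mul2lE x y z : (x * y <= x * z)%g = (y <= z).
Proof. by rewrite !leNgt ltg_mul2lE. Qed.

Lemma leg_mul2rE x y z : (y * x <= z * x)%g = (y <= z).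
Proof. by rewrite !leNgt ltg_mul2rE. Qed.

Lemma leg_mul x y z t : x <= y -> z <= t -> (x * z <= y * t)%g.
Proof. by move=> xy zt; apply: (@le_trans _ _ (y * z)%g); rewrite ?leg_mul2rE ?leg_mul2lE. Qed.

Lemma ltg_mulr x e : 1%g < e -> (x < x * e)%g.
Proof. by move=> e1; rewrite -{1}(mulg1 x) ltg_mul2lE. Qed.

Lemma ltg_divr x e : 1%g < e -> (x / e < x)%g.
Proof. by move=> e1; rewrite -(ltg_mul2rE e) mulgVK ltg_mulr. Qed.

Lemma exists_gt1 (c : G) : c <> 1%g -> exists2 e : G, e = c \/ e = c^-1%g & 1%g < e.
Proof.
move=> c1; have [?|c_lt1|cE] := ltgtP 1%g c; first by exists c; [left|].
  by exists c^-1%g; [right|rewrite -(ltg_mul2lE c) mulg1 mulgV].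
by case: c1.
Qed.

End OrderedGroup.

Section Definability.
Context {L : language} {d : Order.disp_t} {G : orderedGroupType d}.
Variable S : structure L G.

Section Monotone.
Variables (A B : set G).
Hypothesis AB : A `<=` B.

Lemma tdef_sub t : tdef S A t -> tdef S B t.
Proof.
elim=> [i|a Aa|f ts _ IH]; [exact: tdef_var|exact/tdef_const/AB|exact: tdef_app].
Qed.

Lemma pdef_sub P : pdef S A P -> pdef S B P.
Proof.
elim=> {P} [t u dt du|r ts dts|P _ IH|P Q _ IHP _ IHQ|P _ IH].
- by apply: pdef_eq; exact: tdef_sub.
- by apply: pdef_rel => i; exact: tdef_sub.
- exact: pdef_not.
- exact: pdef_and.
- exact: pdef_ex1.
Qed.
End Monotone.

Lemma tdef_comp2 A (f : G -> G -> G) t u : tdef S A (fun v => f (v 0) (v 1)) ->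
  tdef S A t -> tdef S A u -> tdef S A (fun v => f (t v) (u v)).
Proof.
move=> df dt du.
by apply: (tdef_subst (s := fun i v => if i is 0 then t v else u v) _ df) => -[|i].
Qed.

Lemma pdef_comp1 A (X : G -> Prop) t :
  pdef S A (fun v => X (v 0)) -> tdef S A t -> pdef S A (fun v => X (t v)).
Proof. by move=> dX dt; apply: (pdef_subst (s := fun _ v => t v) _ dX). Qed.

Lemma pdef_comp2 A (X : G -> G -> Prop) t u : pdef S A (fun v => X (v 0) (v 1)) ->
  tdef S A t -> tdef S A u -> pdef S A (fun v => X (t v) (u v)).
Proof.
move=> dX dt du.
by apply: (pdef_subst (s := fun i v => if i is 0 then t v else u v) _ dX) => -[|i].
Qed.

Lemma pdef_scons A P t s : pdef S A P -> tdef S A t ->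
  (forall i, tdef S A (fun v => s v i)) -> pdef S A (fun v => P (t v .: s v)).
Proof.
move=> dP dt ds.
have /pdef_subst/(_ dP) : forall i, tdef S A (fun v => (t v .: s v) i) by case.
exact.
Qed.

(** This shared interface lets the same lemmas serve the expansion of the group
    and the further expansion by a constant. *)
Definition defines_ogroup : Prop :=
  [/\ tdef S set0 (fun=> 1%g), tdef S set0 (fun v => (v 0%N)^-1%g),
      tdef S set0 (fun v => (v 0%N * v 1%N)%g) & pdef S set0 (fun v => v 0 < v 1)].

Hypothesis og : defines_ogroup.

Lemma tdef_one A : tdef S A (fun=> 1%g).
Proof. by case: og => d1 _ _ _; apply: tdef_sub d1. Qed.

Lemma tdef_inv A t : tdef S A t -> tdef S A (fun v => (t v)^-1%g).
Proof.
case: og => _ dV _ _ dt; have {}dV := tdef_sub (sub0set A) dV.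
exact: (tdef_comp2 (f := fun x _ => x^-1%g) dV dt dt).
Qed.

Lemma tdef_mul A t u : tdef S A t -> tdef S A u -> tdef S A (fun v => t v * u v)%g.
Proof.
by case: og => _ _ dM _; apply: (tdef_comp2 (f := fun x y => (x * y)%g)); apply: tdef_sub dM.
Qed.

Lemma pdef_lt A t u : tdef S A t -> tdef S A u -> pdef S A (fun v => t v < u v).
Proof.
by case: og => _ _ _ dL; apply: (pdef_comp2 (X := fun x y : G => x < y)); apply: pdef_sub dL.
Qed.

Lemma pdef_le A t u : tdef S A t -> tdef S A u -> pdef S A (fun v => t v <= u v).
Proof.
move=> dt du; apply: pdef_ext (pdef_not (pdef_lt du dt)) => v.
by rewrite leNgt; split=> /negP.
Qed.

End Definability.

(** [solve_tdef] and [solve_pdef] follow the shape of a function or a predicate;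
    the atoms are hypotheses of the context on predicates of one variable, of
    two variables, or of an assignment extended by one value. *)
Ltac solve_tdef := repeat match goal with
  | |- tdef _ _ (fun v => v _) => apply: tdef_var
  | |- tdef _ _ (fun v => (@?t v * @?u v)%g) => apply: tdef_mul
  | |- tdef _ _ (fun v => ((@?t v)^-1)%g) => apply: tdef_inv
  | |- tdef _ _ (fun=> 1%g) => apply: tdef_one
  | H : tdef _ _ _ |- _ => exact: H
  | |- tdef _ setT (fun v => ?a) => by apply: tdef_const
  | H : defines_ogroup _ |- _ => exact: H
  end.

Ltac pdef_step := lazymatch goal with
  | |- pdef _ _ (fun v => @?P v /\ @?Q v) => apply: pdef_and
  | |- pdef _ _ (fun v => @?P v \/ @?Q v) => apply: pdef_or
  | |- pdef _ _ (fun v => ~ @?P v) => apply: pdef_not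
  | |- pdef _ _ (fun v => exists x, @?P v x) => apply: pdef_ex
  | |- pdef _ _ (fun v => is_true (@?t v < @?u v)) => apply: pdef_lt
  | |- pdef _ _ (fun v => is_true (@?t v <= @?u v)) => apply: pdef_le
  | |- pdef _ _ (fun v => @?t v = @?u v) => apply: pdef_eq
  | |- pdef _ _ (fun v => @?P v -> @?Q v) => apply: pdef_imp
  | |- pdef _ _ (fun v => forall x, @?P v x) => apply: pdef_all
  end; rewrite /=.

Ltac solve_pdef := repeat first [ match goal with
  | H : pdef _ _ ?P |- pdef _ _ ?P => exact: H
  | H : pdef _ _ (fun v => ?X (v 0%N)) |- pdef _ _ (fun v => ?X (@?t v)) =>
      apply: (pdef_comp1 H)
  | H : pdef _ _ (fun v => ?R (v 0%N) (v 1%N)) |- pdef _ _ (fun v => ?R (@?t v) (@?u v)) =>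
      apply: (pdef_comp2 H)
  | H : pdef _ _ ?P |- pdef _ _ (fun v => ?P (@?t v .: @?s v)) =>
      apply: (pdef_scons H); [|let i := fresh "i" in move=> i /=]
  end | pdef_step ]; solve_tdef.

(** * Definable completeness and o-minimality *)

Section Completeness.
Context {L : language} {d : Order.disp_t} {G : orderedGroupType d}.
Variable S : structure L G.
Hypothesis og : defines_ogroup S.

Definition definably_complete : Prop :=
  forall X : set G, definable1 S X -> X !=set0 -> has_ubound X ->
  supremums X !=set0.

Lemma definable1_lbound (X : set G) : definable1 S X -> definable1 S (lbound X).
Proof. rewrite !(definable1P S 1%g) => dX; rewrite /lbound /=; solve_pdef. Qed.

(** An infimum is a supremum of the set of lower bounds. *)
Lemma definably_complete_inf : definably_complete -> forall X : set G,
  definable1 S X -> X !=set0 -> has_lbound X -> infimums X !=set0.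
Proof.
move=> dc X dX [x Xx] lbX.
have [|l /supremums_lbound] := dc _ (definable1_lbound dX) lbX; last by exists l.
by exists x => y; apply.
Qed.

Section Complete.
Hypotheses (dG : dense_order G) (nomax : forall x : G, exists y, x < y).

(** One of the intervals is cofinal in the set, and its right endpoint is the
    supremum. *)
Lemma o_minimal_complete : o_minimal S -> definably_complete.
Proof.
move=> [_ omin] X /omin[n [I XI]] X0 [u ubX].
have [i Icof] : exists i, forall x, X x -> exists2 y, [set` I i] y & x <= y.
  by rewrite XI in X0 *; exact: cofinal_part.
have IX : [set` I i] `<=` X by rewrite XI => x Ix; exists i.
have [||l [ubl lubl]] := interval_supremums (I := I i) dG nomax.
- by have [x /Icof[y]] := X0; exists y.
- by exists u => x /IX /ubX.
exists l; split=> [x /Icof[y /ubl yl xy]|y uby]; first exact: le_trans yl.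
by apply: lubl => x /IX /uby.
Qed.

Definition component (X : set G) x : set G :=
  [set y | forall z, x <= z <= y \/ y <= z <= x -> X z].

Lemma component_convex X x : order_convex (component X x).
Proof.
move=> y1 y y2 H1 H2 /andP[/ltW y1y /ltW yy2] z [|] /andP[a b].
  by apply: H2; left; rewrite a (le_trans b).
by apply: H1; right; rewrite b (le_trans y1y).
Qed.

Lemma component_sub X x : component X x `<=` X.
Proof. by move=> y; apply; case/orP: (le_total x y) => xy; [left|right]; rewrite xy lexx. Qed.

Lemma sub_component X C x : order_convex C -> C `<=` X -> C x -> C `<=` component X x.
Proof.
move=> cC CX Cx y Cy z [] /andP[a b]; apply: CX.
  exact: order_convexW cC Cx Cy a b.
exact: order_convexW cC Cy Cx a b.
Qed.

Lemma definable1_component X x : definable1 S X -> definable1 S (component X x).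
Proof.
rewrite !(definable1P S 1%g) => dX.
apply: (@pdef_ext _ _ _ _ (fun v => forall z, (x <= z /\ z <= v 0) \/ (v 0 <= z /\ z <= x) -> X z)).
  by move=> v; split=> H z Hz; apply: H; case: Hz => [/andP|/andP]; [left|right|left|right].
by solve_pdef.
Qed.

(** The convex parts given by weak o-minimality need not be definable; the
    convex components containing them are, so completeness turns these into
    intervals. *)
Lemma complete_o_minimal : weakly_o_minimal S -> definably_complete -> o_minimal S.
Proof.
move=> [_ wom] dc; split=> // X dX; have [n [C [cC XC]]] := wom X dX.
have CX i : C i `<=` X by rewrite XC => x Cx; exists i.
have /choice[I IP] : forall i, exists I : interval G, C i `<=` [set` I] /\ [set` I] `<=` X.
  move=> i; have [[x Cx]|C0] := pselect (C i !=set0); last first.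
    exists `]1%g, 1%g[; split=> x; first by move=> Cx; case: C0; exists x.
    by rewrite /= in_itv /= => /andP[/lt_trans/[apply]]; rewrite ltxx.
  have Kx : component X x x by apply: (sub_component (cC i)).
  have dK := definable1_component x dX.
  have [|||I KI] := convex_itv (@component_convex X x).
  - by apply: dc => //; exists x.
  - by apply: definably_complete_inf => //; exists x.
  - by exists x.
  by exists I; rewrite -KI; split; [exact: sub_component|exact: component_sub].
exists n, I; apply/seteqP; split=> x; first by rewrite XC => -[i _ /(IP i).1]; exists i.
by move=> [i _ /(IP i).2].
Qed.

End Complete.

(** * Non-realized cuts *)

(** If [C * t] were included in [C], then [t] would belong to the subgroup [H]
    of right translations preserving [C], which is definable and convex, hence
    trivial or everything; but no translation of [H] moves a point of [C] to a
    point outside [C]. *)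
Lemma cut_translate (C : set G) t : non_valuational S -> definable1 S C ->
  (forall x y, x <= y -> C y -> C x) -> C !=set0 -> ~` C !=set0 ->
  1%g < t -> exists2 y, C y & ~ C (y * t)%g.
Proof.
move=> nv dC dwn [a Ca] [b nCb] t1; apply: contrapT => nex.
have Ct x : C x -> C (x * t)%g.
  by move=> Cx; apply: contrapT => nCxt; apply: nex; exists x.
pose H : set G := [set h | forall x, (C x -> C (x * h)%g) /\ (C (x * h)%g -> C x)].
have dH : definable1 S H.
  by move: dC; rewrite !(definable1P S 1%g) /H /= => dC; solve_pdef.
have cH : order_convex H.
  move=> h1 h h2 H1 H2 /andP[/ltW h1h /ltW hh2] x; split=> [/(H2 x).1|].
    by apply: dwn; rewrite leg_mul2lE.
  by move=> Cxh; apply/(H1 x).2; apply: dwn Cxh; rewrite leg_mul2lE.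
have sH : is_subgroup H.
  split=> [x|h k Hh Hk x]; first by rewrite mulg1.
  rewrite mulgA; split=> [/(Hh x).1 Cxh|Cxhk].
    by apply/(Hk _).2; rewrite mulgVK.
  by apply/(Hh x).2; move/(Hk _).1: Cxhk; rewrite mulgVK.
have Ht : H t by move=> x; split=> [/Ct//|]; apply: dwn; rewrite ltW ?ltg_mulr.
have [H1|HT] := nv H dH cH sH.
  by move: Ht t1; rewrite H1 => ->; rewrite ltxx.
have : H (a^-1 * b)%g by rewrite HT.
by move=> /(_ a)[/(_ Ca) + _]; rewrite mulVKg.
Qed.

(** The downward closure [C] of a set without supremum has no greatest element
    and its complement no least one. Given [u < w] in [C], if [f t < u] with
    [t < u^-1 * w] then [f t * t < w] is in [C]; so [f] is not eventually below
    any [u] in [C], nor above any [u] outside, and its limit can be nowhere. *)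
Lemma Skolem_complete c :
  dense_order G -> (exists e : G, 1%g < e) ->
  non_valuational S -> no_external_limits S ->
  has_definable_Skolem_functions (name_constant S c) -> definably_complete.
Proof.
move=> dG [e e1] nv nel sk X dX [a Xa] [b ubX]; apply: contrapT => nosup.
pose C := [set z | exists y, X y /\ z <= y].
have dC : definable1 S C.
  by move: dX; rewrite !(definable1P S 1%g) /C /= => dX; solve_pdef.
have dwn x y : x <= y -> C y -> C x.
  by move=> xy [z [Xz yz]]; exists z; split=> //; exact: le_trans yz.
have XC : X `<=` C by move=> x; exists x.
have nomax x : C x -> exists2 y, C y & x < y.
  move=> Cx; apply: contrapT => ny; apply: nosup; exists x; split.
    move=> y /XC Cy; rewrite leNgt; apply/negP => xy; apply: ny; by exists y.
  by case: Cx => y [Xy xy] z /(_ y Xy); exact: le_trans.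
have nomin x : ~ C x -> exists2 y, ~ C y & y < x.
  move=> nCx; apply: contrapT => ny; apply: nosup; exists x; split.
    move=> y /XC Cy; rewrite leNgt; apply/negP => /ltW xy; apply: nCx; exact: dwn Cy.
  move=> z ubz; rewrite leNgt; apply/negP => zx.
  have Cz : C z by apply: contrapT => nCz; apply: ny; exists z.
  by have [w [y [Xy wy]]] := nomax _ Cz; rewrite ltNge (le_trans wy) ?ubz.
have exC t : 1%g < t -> exists y, C y /\ ~ C (y * t)%g.
  move=> t1; have [||y ? ?] := cut_translate nv dC dwn _ _ t1; last by exists y.
    by exists a; exact: XC.
  exists b => Cb; have [w [y [Xy wy]]] := nomax _ Cb.
  by rewrite ltNge (le_trans wy) ?ubX.
pose R t y := 1%g < t -> C y /\ ~ C (y * t)%g.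
have dR : pdef (name_constant S c) setT (fun v => R (v 0) (v 1)).
  apply/pdef_name_constant; move: dC; rewrite (definable1P S 1%g) => dC'.
  by rewrite /R; solve_pdef.
have [f df fR] := Skolem_choice 1%g sk dR.
have {}fR t : 1%g < t -> C (f t) /\ ~ C (f t * t)%g.
  move=> t1; apply: (fR t) => //; have [y Cy] := exC t t1; by exists y.
have [|[l [Hl Hr]] _] := nel (Fin 1%g) (PInfty G) f isT.
  apply/(definable2P S 1%g (fun x y => open_itv (Fin 1%g) (PInfty G) x /\ y = f x)).
  move/pdef_name_constant in df.
  apply: (@pdef_ext _ _ _ _ (fun v => 1%g < v 0 /\ v 1 = f (v 0))).
    by move=> v; split=> [[]|[[]]].
  by solve_pdef.
have below u : C u -> ~ (eventually_right (Fin 1%g) (PInfty G) (fun t => f t < u)).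
  move=> Cu [s [s1 _] fs]; have [w Cw uw] := nomax _ Cu.
  have uw1 : 1%g < (u^-1 * w)%g by rewrite -(ltg_mul2lE u) mulg1 mulVKg.
  have : 1%g < Order.min s (u^-1 * w)%g by rewrite lt_min uw1 andbT.
  case/dG => t /andP[t1]; rewrite lt_min => /andP[ts tuw].
  have [_] := fR _ t1; apply; apply: dwn Cw.
  rewrite -(mulVKg u w) leg_mul // ltW //; exact: fs.
have above u : ~ C u -> ~ (eventually_right (Fin 1%g) (PInfty G) (fun t => u < f t)).
  move=> nCu [s [s1 _] fs]; have [t /andP[t1 ts]] := dG _ _ s1.
  have [Cf _] := fR _ t1; apply: nCu; apply: dwn Cf; rewrite ltW //; exact: fs.
have [Cl|nCl] := pselect (exists2 u, C u & lt_endpoint l (Fin u)).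
  by have [u Cu /Hr] := Cl; exact: below.
have [nCl2|] := pselect (exists2 u, ~ C u & lt_endpoint (Fin u) l).
  by have [u nCu /Hl] := nCl2; exact: above.
case: l {Hl Hr} nCl => [|l|] nCl nCl'.
- by apply: nCl; exists a => //; exact: XC.
- have [/nomax[u ? ?]|/nomin[u ? ?]] := pselect (C l); first by apply: nCl; exists u.
  by apply: nCl'; exists u.
apply: nCl'; have [u nCu] : exists u, ~ C u; last by exists u.
have [y [_ ?]] := exC e e1; by eexists; eassumption.
Qed.

End Completeness.

(** * Limits of definable functions *)

(** A convex set with arbitrarily low points in [J] contains all points of [J]
    below one of its own. *)
Lemma germ_dichotomy {d} {T : orderType d} (J : set T) n (C : 'I_n -> set T) :
  (forall i, order_convex (C i)) -> J !=set0 ->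
  (forall s, J s -> exists2 t, J t & t < s) ->
  (exists2 s, J s & forall t, J t -> t < s -> exists i, C i t) \/
  (exists2 s, J s & forall t, J t -> t < s -> ~ exists i, C i t).
Proof.
move=> cC [s0 Js0] nomin.
have [[i Ci]|nC] := pselect (exists i, forall s, J s -> exists t, [/\ J t, C i t & t < s]).
  left; have [s [Js Cs _]] := Ci _ Js0; exists s => // t Jt ts; exists i.
  have [u [_ Cu ut]] := Ci _ Jt.
  by apply: (cC i u t s); rewrite ?ut.
right; have /choice[g gP] : forall i, exists s, J s /\ forall t, J t -> C i t -> s <= t.
  move=> i; apply: contrapT => ns; apply: nC; exists i => s Js.
  apply: contrapT => nt; apply: ns; exists s; split=> // t Jt Ct.
  by rewrite leNgt; apply/negP => ts; apply: nt; exists t.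
have [[i0 _]|n0] := pselect (exists i : 'I_n, True); last first.
  by exists s0 => // t _ _ [i _]; apply: n0; exists i.
have [i _ gi] := arg_minP g (isT : xpredT i0).
exists (g i); first exact: (gP i).1.
move=> t Jt; rewrite ltNge => /negP nt [j Cjt]; apply: nt.
by apply: le_trans (gi j isT) _; exact: (gP j).2.
Qed.

Section Limits.
Context {L : language} {d : Order.disp_t} {G : orderedGroupType d}.
Variable S : structure L G.
Hypothesis og : defines_ogroup S.
Hypotheses (dG : dense_order G).
Hypotheses (nomax : forall x : G, exists y, x < y) (nomin : forall x : G, exists y, y < x).

Lemma open_itv_nonempty (a b : endpoint G) : lt_endpoint a b -> open_itv a b !=set0.
Proof.
case: a b => [|a|] [|b|] //= ab.
- by have [y] := nomin b; exists y.
- by exists 1%g.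
- by have [y /andP[]] := dG ab; exists y.
- by have [y] := nomax a; exists y.
Qed.

Lemma open_itv_nomin (a b : endpoint G) s : open_itv a b s ->
  exists2 t, open_itv a b t & t < s.
Proof.
move=> [as_ sb]; have [t [at_ ts]] := open_itv_nonempty as_.
exists t => //; split=> //; by case: b sb => //= b; exact: lt_trans.
Qed.

Lemma open_itv_nomax (a b : endpoint G) s : open_itv a b s ->
  exists2 t, open_itv a b t & s < t.
Proof.
move=> [as_ sb]; have [t [st tb]] := open_itv_nonempty sb.
exists t => //; split=> //; case: a as_ => //= a as_; exact: lt_trans st.
Qed.

Lemma eventually_rightE (a b : endpoint G) P : eventually_right a b P <->
  exists2 s, open_itv a b s & forall t, open_itv a b t -> t < s -> P t.
Proof.
split=> -[s Js HP]; exists s => // t.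
  by move=> [at_ _] ts; apply: HP.
move=> [at_ ts]; apply: HP => //; split=> //.
by case: Js => _; case: b => //= b; exact: lt_trans.
Qed.

Lemma eventually_leftE (a b : endpoint G) P : eventually_left a b P <->
  exists2 s, open_itv a b s & forall t, open_itv a b t -> s < t -> P t.
Proof.
split=> -[s Js HP]; exists s => // t.
  by move=> [_ tb] ts; apply: HP.
move=> [st tb]; apply: HP => //; split=> //.
by case: Js => + _; case: a => //= a as_; exact: lt_trans st.
Qed.

(** The limit is the supremum of the values that [f] eventually exceeds; [ev]
    stands for either one-sided filter. *)
Lemma tends_to_exists (ev : (G -> Prop) -> Prop) (f : G -> G) :
  definably_complete S ->
  (forall P Q : G -> Prop, (forall t, P t -> Q t) -> ev P -> ev Q) ->
  (forall v, ev (fun t => v < f t) \/ ev (fun t => ~ v < f t)) ->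
  definable1 S [set u | ev (fun t => u < f t)] ->
  exists l, tends_to ev f l.
Proof.
move=> dc evS dich; set A := [set _ | _] => dA.
have small v w : ~ A v -> v < w -> ev (fun t => f t < w).
  move=> nAv vw; have [//|] := dich v.
  by apply: evS => t /negP; rewrite -leNgt => /le_lt_trans; apply.
have big u w : A w -> u <= w -> ev (fun t => u < f t).
  by move=> Aw uw; apply: evS Aw => t; exact: le_lt_trans.
have [A0|/nonemptyPn A0] := pselect (A !=set0); last first.
  exists (NInfty G); split=> [//|v _]; have [v' v'v] := nomin v.
  by apply: small v'v; rewrite A0.
have [bA|nbA] := pselect (has_ubound A); last first.
  exists (PInfty G); split=> [u _|//].
  have [w Aw uw] : exists2 w, A w & u < w.
    apply: contrapT => nw; apply: nbA; exists u => w Aw.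
    by rewrite leNgt; apply/negP => uw; apply: nw; exists w.
  exact: big (ltW uw).
have [l /supremumsP[ubl lubl]] := dc A dA A0 bA.
exists (Fin l); split=> [u /lubl[w Aw uw]|v /= lv]; first exact: big (ltW uw).
have [w /andP[lw wv]] := dG lv; apply: small wv => /ubl.
by rewrite leNgt lw.
Qed.

Lemma complete_no_external_limits :
  weakly_o_minimal S -> definably_complete S -> no_external_limits S.
Proof.
move=> [_ wom] dc a b f ab.
pose J := open_itv a b; pose R t y := J t /\ y = f t.
move=> /(definable2P S 1%g R) dR.
have J0 : J !=set0 by exact: open_itv_nonempty.
have RP t : J t -> R t (f t) by [].
have split_f v : exists n (C : 'I_n -> set G), (forall i, order_convex (C i)) /\
    forall t, J t -> (exists i, C i t) <-> v < f t.
  have [|n [C [cC XC]]] := wom [set t | exists y, R t y /\ v < y].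
    by apply/(definable1P S 1%g) => /=; solve_pdef.
  exists n, C; split=> // t Jt.
  have <- : (exists y, R t y /\ v < y) <-> v < f t.
    by split=> [[y [[_ ->]]]|]; last by exists (f t).
  have -> : (exists y, R t y /\ v < y) = (\bigcup_i C i) t by rewrite -XC.
  by split=> [[i]|[i _]]; exists i.
split; apply: tends_to_exists => //.
- move=> P Q PQ /eventually_rightE[s Js HP]; apply/eventually_rightE; exists s => // t Jt ts.
  exact/PQ/HP.
- move=> v; have [n [C [cC CE]]] := split_f v.
  have [] := germ_dichotomy cC J0 (@open_itv_nomin a b) => -[s Js Hs]; [left|right];
    apply/eventually_rightE; exists s => // t Jt ts; have := Hs t Jt ts; by rewrite CE.
- rewrite (_ : [set u | _] = [set u | exists s, (exists y, R s y) /\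
     forall t y, R t y -> t < s -> u < y]).
    by apply/(definable1P S 1%g) => /=; solve_pdef.
  apply/seteqP; split=> u.
    move=> /eventually_rightE[s Js Hs]; exists s; split; first by exists (f s).
    by move=> t y [Jt ->]; exact: Hs.
  move=> [s [[y [Js _]] Hs]]; apply/eventually_rightE; exists s => // t Jt.
  by apply: Hs.
- move=> P Q PQ /eventually_leftE[s Js HP]; apply/eventually_leftE; exists s => // t Jt ts.
  exact/PQ/HP.
- move=> v; have [n [C [cC CE]]] := split_f v.
  (* the germ at the right end is the germ at the left end of the dual order *)
  have cC' i : order_convex (C i : set G^d).
    by move=> x y z Cx Cz /andP[xy yz]; apply: (cC i z y x) => //; apply/andP.
  have [] := germ_dichotomy (T := G^d) cC' J0 (@open_itv_nomax a b) => -[s Js Hs]; [left|right];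
    apply/eventually_leftE; exists s => // t Jt ts; have := Hs t Jt ts; by rewrite CE.
rewrite (_ : [set u | _] = [set u | exists s, (exists y, R s y) /\
   forall t y, R t y -> s < t -> u < y]).
  by apply/(definable1P S 1%g) => /=; solve_pdef.
apply/seteqP; split=> u.
  move=> /eventually_leftE[s Js Hs]; exists s; split; first by exists (f s).
  by move=> t y [Jt ->]; exact: Hs.
move=> [s [[y [Js _]] Hs]]; apply/eventually_leftE; exists s => // t Jt.
by apply: Hs.
Qed.

End Limits.

(** * Definable functions of an assignment *)

Section DefinableFunctions.
Context {L : language} {d : Order.disp_t} {G : orderedGroupType d}.
Variable S : structure L G.
Hypothesis og : defines_ogroup S.

(** The graph is definable, with the value stored in variable 0. *)
Definition fdef (f : (nat -> G) -> G) : Prop :=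
  pdef S set0 (fun v => v 0 = f (fun i => v i.+1)).

Lemma fdef_tdef t : tdef S set0 t -> fdef t.
Proof. by move=> dt; apply: pdef_eq; [exact: tdef_var|exact: tdef_shift]. Qed.

Lemma fdef_subst f s : fdef f -> (forall i, tdef S set0 (s i)) ->
  fdef (fun v => f (fun i => s i v)).
Proof.
move=> df ds; have /pdef_subst/(_ df) : forall i, tdef S set0
    (fun v => (v 0 .: fun j => s j (fun k => v k.+1)) i).
  by case=> [|i] /=; [exact: tdef_var|exact: tdef_shift].
exact.
Qed.

Lemma fdef_shift f : fdef f -> fdef (fun v => f (fun i => v i.+1)).
Proof. by move=> df; apply: (fdef_subst (s := fun i v => v i.+1)) => // i; solve_tdef. Qed.

Lemma pdef_let f (P : (nat -> G) -> Prop) : fdef f -> pdef S set0 P ->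
  pdef S set0 (fun v => P (f v .: v)).
Proof.
move=> df dP; apply: (@pdef_ext _ _ _ _ (fun v => exists x, x = f v /\ P (x .: v))).
  by move=> v; split=> [[x [->]]|]; last by exists (f v).
apply/pdef_ex/pdef_and => //; apply: pdef_ext dP => v; by rewrite scons_eta.
Qed.

(** Composition in the first variable of [h] only: the other variables remain
    available to [h]. *)
Lemma fdef_comp h f : fdef h -> fdef f -> fdef (fun v => h (f v .: v)).
Proof.
move=> dh df; rewrite /fdef.
apply: (pdef_let (P := fun w => w 1 = h (w 0 .: fun i => w i.+2)) (fdef_shift df)).
have /pdef_subst/(_ dh) : forall i, tdef S set0
    (fun w => (w 1 .: w 0 .: fun j => w j.+2) i) by case=> [|[|i]] /=; solve_tdef.
by move=> H; exact: H.
Qed.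

Lemma fdef_mul f g : fdef f -> fdef g -> fdef (fun v => f v * g v)%g.
Proof.
move=> df dg.
apply: (fdef_comp (h := fun w => (w 0%N * g (fun i => w i.+1))%g) _ df).
apply: (fdef_comp (h := fun w => (w 1%N * w 0%N)%g) _ (fdef_shift dg)).
by apply: fdef_tdef; solve_tdef.
Qed.

Lemma fdef_inv f : fdef f -> fdef (fun v => (f v)^-1)%g.
Proof.
by apply: (fdef_comp (h := fun w => ((w 0%N)^-1)%g)); apply: fdef_tdef; solve_tdef.
Qed.

Lemma fdef_the Q : pdef S set0 Q ->
  (forall v, is_subset1 [set x | Q (x .: v)]) ->
  fdef (fun v => xget 1%g [set x | Q (x .: v)]).
Proof.
move=> dQ Q1.
have dE : pdef S set0 (fun v => exists x, Q (x .: fun i => v i.+1)) by solve_pdef.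
have d1 : pdef S set0 (fun v => v 0 = 1%g) by solve_pdef.
apply: pdef_ext (pdef_or dQ (pdef_and (pdef_not dE) d1)) => v.
rewrite -{1}(scons_eta v); move: (v 0) (fun i => v i.+1) => x w.
split=> [[Qx|[nQ ->]]|->].
- by rewrite (xget_subset1 _ (x := x)).
- by rewrite xgetPN // => y Qy; apply: nQ; exists y.
case: xgetP => [y _ Qy|nQ]; first by left.
by right; split=> // -[y]; exact: nQ.
Qed.

Lemma fdef_if P f g : pdef S set0 P -> fdef f -> fdef g ->
  fdef (fun v => if `[< P v >] then f v else g v).
Proof.
move=> dP df dg.
have dP' : pdef S set0 (fun v => P (fun i => v i.+1)).
  by apply: (pdef_subst (s := fun i v => v i.+1) _ dP) => i; solve_tdef.
apply: pdef_ext (pdef_or (pdef_and dP' df) (pdef_and (pdef_not dP') dg)) => v.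
by case: asboolP => Pv; split=> [[[]|[]]|->]; tauto.
Qed.

Definition sup_fiber (P : (nat -> G) -> Prop) (v : nat -> G) : G :=
  xget 1%g (supremums [set x | P (x .: v)]).

Lemma fdef_sup P : pdef S set0 P -> fdef (sup_fiber P).
Proof.
move=> dP; apply: (fdef_the (Q := fun w => supremums [set x | P (x .: fun i => w i.+1)] (w 0))).
  by rewrite /supremums /ubound /lbound /setI /mkset /=; solve_pdef.
by move=> v x y hx hy; exact: (is_subset1_supremums hx hy).
Qed.

End DefinableFunctions.

(** * Definable choice *)

Section Half.
Context {d : Order.disp_t} {G : orderedGroupType d}.
Hypothesis dG : dense_order G.

(** Density provides [e > 1] with [e * e <= x]: either [y] or [y^-1 * x], for
    any [y] between [1] and [x]. Then [e] is one of the [y], and all of them are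
    at most [x / e], since [x <= (x / e) * (x / e)]. *)
Lemma sup_square_between (x s : G) : 1%g < x ->
  supremums [set y : G | (y * y <= x)%g] s -> 1%g < s < x.
Proof.
move=> x1 [ub lub].
have [e e1 ee] : exists2 e : G, 1%g < e & (e * e <= x)%g.
  have [y /andP[y1 yx]] := dG x1; have [yy|yy] := leP (y * y)%g x; first by exists y.
  exists (y^-1 * x)%g; first by rewrite -(ltg_mul2lE y) mulg1 mulVKg.
  have yxy : (y^-1 * x < y)%g by rewrite -(ltg_mul2lE y) mulVKg.
  by rewrite -[leRHS](mulVKg y x) leg_mul2rE ltW.
rewrite (lt_le_trans e1) /=; last exact: ub.
apply: le_lt_trans (ltg_divr x e1); apply: lub => y /= yy.
rewrite leNgt; apply/negP => xey; move: yy; apply/negP; rewrite -ltNge.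
have xxe : (x <= (x / e) * (x / e))%g.
  have e_xe : (e <= x / e)%g by rewrite -(leg_mul2rE e) mulgVK.
  by rewrite -{1}(mulgVK e x) leg_mul2lE.
by apply: le_lt_trans xxe _; rewrite (lt_trans (_ : _ < (x / e) * y)%g) ?ltg_mul2lE ?ltg_mul2rE.
Qed.

(** The four candidates correspond to [Y] being bounded or not on each side.
    Each of them lies strictly within the bounds, and [Y] being convex contains
    everything strictly between its infimum and its supremum. *)
Lemma convex_point (Y : set G) (a b e : G) (h : G -> G) :
  1%g < e -> order_convex Y -> Y !=set0 -> (forall y, Y y -> exists2 z, Y z & z < y) ->
  (has_lbound Y -> infimums Y a) -> (has_ubound Y -> supremums Y b) ->
  (forall x, 1%g < x -> 1%g < h x < x) ->
  [\/ Y 1%g, Y (b / e)%g, Y (a * e)%g | Y (a * h (a^-1 * b))%g].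
Proof.
move=> e1 cY [y0 Yy0] nomin infY supY hP.
have above x : ~ has_lbound Y \/ (infimums Y a /\ a < x) -> exists2 y, Y y & y <= x.
  case=> [nlb|[/infimumsP[_ glb] /glb[y Yy yx]]]; last by exists y => //; exact: ltW.
  apply: contrapT => ny; apply: nlb; exists x => y Yy.
  by rewrite leNgt; apply/negP => yx; apply: ny; exists y => //; exact: ltW.
have below x : ~ has_ubound Y \/ (supremums Y b /\ x < b) -> exists2 y, Y y & x <= y.
  case=> [nub|[/supremumsP[_ lub] /lub[y Yy yx]]]; last by exists y => //; exact: ltW.
  apply: contrapT => ny; apply: nub; exists x => y Yy.
  by rewrite leNgt; apply/negP => yx; apply: ny; exists y => //; exact: ltW.
have mem x : (exists2 y, Y y & y <= x) -> (exists2 y, Y y & x <= y) -> Y x.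
  by move=> [y Yy yx] [z Yz xz]; exact: order_convexW cY Yy Yz yx xz.
have [lb|nlb] := pselect (has_lbound Y); have [ub|nub] := pselect (has_ubound Y).
- have [infa supb] := (infY lb, supY ub).
  have ab : a < b.
    have [y Yy yy0] := nomin _ Yy0.
    by apply: (le_lt_trans (infa.1 _ Yy)); apply: lt_le_trans yy0 _; exact: supb.1.
  have : 1%g < (a^-1 * b)%g by rewrite -(ltg_mul2lE a) mulg1 mulVKg.
  move=> /hP/andP[h1 hab]; constructor 4; apply: mem.
    by apply: above; right; split=> //; exact: ltg_mulr.
  by apply: below; right; split=> //; rewrite -{2}(mulVKg a b) ltg_mul2lE.
- constructor 3; apply: mem; last by apply: below; left.
  by apply: above; right; split; [exact: infY|exact: ltg_mulr].
- constructor 2; apply: mem; first by apply: above; left.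
  by apply: below; right; split; [exact: supY|exact: ltg_divr].
- by constructor 1; apply: mem; [apply: above|apply: below]; left.
Qed.

End Half.

Section Skolem.
Context {L : language} {d : Order.disp_t} {G : orderedGroupType d}.
Variable S : structure L G.
Hypotheses (og : defines_ogroup S) (dG : dense_order G).
Variable e : G.
Hypotheses (e1 : 1%g < e) (de : tdef S set0 (fun=> e)).
Hypotheses (wom : weakly_o_minimal S) (dc : definably_complete S).

Lemma definable1_fiber P v : pdef S set0 P -> definable1 S [set x | P (x .: v)].
Proof.
move=> dP; apply/(definable1P S 1%g) => /=; apply: pdef_scons.
- exact: pdef_sub dP.
- exact: tdef_var.
- by move=> i; exact: tdef_const.
Qed.

Lemma sup_fiberP P v : pdef S set0 P -> [set x | P (x .: v)] !=set0 ->
  has_ubound [set x | P (x .: v)] ->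
  supremums [set x | P (x .: v)] (sup_fiber P v).
Proof. by move=> dP ne ub; apply: xgetPex; apply: dc => //; exact: definable1_fiber. Qed.

Lemma fdef_or P f g : pdef S set0 P -> fdef S f -> fdef S g ->
  exists2 h, fdef S h & forall v, P (f v .: v) \/ P (g v .: v) -> P (h v .: v).
Proof.
move=> dP df dg; exists (fun v => if `[< P (f v .: v) >] then f v else g v).
  by apply: fdef_if => //; exact: pdef_let.
by move=> v; case: asboolP => // nP [].
Qed.

Section Choice.
Variable P : (nat -> G) -> Prop.
Hypothesis dP : pdef S set0 P.

(** The part of the set [P] of values of variable 0 that lies below its first
    gap: its lowest convex component, if there is one. *)
Definition low_part (w : nat -> G) : Prop :=
  let v i := w i.+1 in
  P w /\ forall x z, P (x .: v) -> x <= z -> z <= w 0 -> P (z .: v).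

Lemma pdef_low_part : pdef S set0 low_part.
Proof. rewrite /low_part; solve_pdef. Qed.

Definition low_bound (w : nat -> G) : Prop := forall y, P (y .: fun i => w i.+1) -> w 0 <= y.

Lemma pdef_low_bound : pdef S set0 low_bound.
Proof. rewrite /low_bound; solve_pdef. Qed.

Definition square_below (w : nat -> G) : Prop := (w 0%N * w 0%N <= w 1%N)%g.

(** Either the infimum [a] belongs to the set, or its low part has no least
    element and [convex_point] applies to it. That the low part is nonempty
    comes from weak o-minimality: it includes a convex part that is coinitial in
    the set. *)
Lemma fdef_choice : exists2 f, fdef S f &
  forall v, (exists x, P (x .: v)) -> P (f v .: v).
Proof.
pose a := sup_fiber low_bound; pose b := sup_fiber low_part.
pose h x v := sup_fiber square_below (x .: v).
have da : fdef S a by apply: fdef_sup => //; exact: pdef_low_bound.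
have db : fdef S b by apply: fdef_sup => //; exact: pdef_low_part.
have d1 : fdef S (fun=> 1%g) by apply: fdef_tdef; solve_tdef.
have dE : fdef S (fun=> e) by exact: fdef_tdef.
have dbe : fdef S (fun v => b v / e)%g by apply: fdef_mul => //; exact: fdef_inv.
have dae : fdef S (fun v => a v * e)%g by exact: fdef_mul.
have dm : fdef S (fun v => a v * h ((a v)^-1 * b v) v)%g.
  apply: fdef_mul => //; apply: fdef_comp => //.
    apply: fdef_sup => //; rewrite /square_below; solve_pdef.
  by apply: fdef_mul => //; exact: fdef_inv.
have [f1 df1 f1P] := fdef_or dP dbe dae.
have [f2 df2 f2P] := fdef_or dP d1 df1.
have [f3 df3 f3P] := fdef_or dP df2 dm.
have [f df fP] := fdef_or dP da df3.
exists f => // v [x0 Px0]; apply: fP.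
pose X := [set x | P (x .: v)].
have [[m Xm minm]|nomin] := pselect (exists2 m, X m & forall x, X x -> m <= x).
  left; rewrite (_ : a v = m) //; apply: xget_subset1; last exact: is_subset1_supremums.
  by split=> [y|y]; apply.
right; apply: f3P.
pose Y := [set x | low_part (x .: v)].
have Ydown x y : Y y -> X x -> x <= y -> Y x.
  move=> [_ Yy] Xx xy; split=> // u z Xu uz zx; apply: Yy Xu uz _; exact: le_trans xy.
have YX : Y `<=` X by move=> y [].
have {}nomin x : X x -> exists2 z, X z & z < x.
  move=> Xx; apply: contrapT => nz; apply: nomin; exists x => // z Xz.
  by rewrite leNgt; apply/negP => zx; apply: nz; exists z.
have cY : order_convex Y.
  move=> y1 y y2 Yy1 Yy2 /andP[/ltW y1y /ltW yy2]; apply: (Ydown _ _ Yy2) => //.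
  by apply: Yy2.2 (YX _ Yy1) y1y yy2.
have Y0 : Y !=set0.
  have [n [C [cC XC]]] := wom.2 X (definable1_fiber v dP).
  have CX i x : C i x -> X x by rewrite XC => Cx; exists i.
  have [|i Ci] := cofinal_part (T := G^d) (C := C); first by rewrite -XC; exists x0.
  have [y Cy _] : exists2 y, C i y & y <= x0 by apply: Ci; rewrite -XC.
  exists y; split; first exact: CX Cy.
  move=> x z /= Xx xz zy.
  have [u Cu ux] : exists2 u, C i u & u <= x by apply: Ci; rewrite -XC.
  by apply: (CX i); apply: order_convexW (cC i) Cu Cy _ zy; exact: le_trans ux xz.
have infY : has_lbound Y -> infimums Y (a v).
  move=> [l lbl]; apply: supremums_lbound.
  have <- : lbound X = lbound Y.
    apply/seteqP; split=> z lbz x; first by move=> /YX; exact: lbz.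
    move=> Xx; have [y Yy] := Y0; case/orP: (le_total x y) => [/(Ydown _ _ Yy Xx)/lbz//|yx].
    by apply: le_trans yx; exact: lbz.
  apply: sup_fiberP; first exact: pdef_low_bound.
    exists l => x Xx; have [y Yy] := Y0.
    by case/orP: (le_total x y) => [/(Ydown _ _ Yy Xx)/lbl//|yx]; apply: le_trans yx; exact: lbl.
  by exists x0 => y; apply.
have supY : has_ubound Y -> supremums Y (b v).
  by apply: sup_fiberP => //; exact: pdef_low_part.
have nominY y : Y y -> exists2 z, Y z & z < y.
  move=> Yy; have [z Xz zy] := nomin _ (YX _ Yy); exists z => //.
  by apply: (Ydown _ _ Yy) => //; exact: ltW.
have hP x : 1%g < x -> 1%g < h x v < x.
  move=> x1; apply: (sup_square_between dG x1); apply: (sup_fiberP (P := square_below)).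
  - by rewrite /square_below; solve_pdef.
  - by exists 1%g; rewrite /square_below /= mulg1 ltW.
  exists x => y /= yy; rewrite leNgt; apply/negP => xy; move: yy.
  rewrite /square_below /= leNgt (lt_trans xy) // ltg_mulr //; exact: lt_trans xy.
have [Y1|Ybe|Yae|Yah] := convex_point e1 cY Y0 nominY infY supY hP.
- by left; apply: f2P; left; exact: YX.
- by left; apply: f2P; right; apply: f1P; left; exact: YX.
- by left; apply: f2P; right; apply: f1P; right; exact: YX.
- by right; exact: YX.
Qed.

End Choice.

(** The graph is definable, with the values in the first [n] variables and the
    arguments in the following ones. *)
Definition fdefn n (F : (nat -> G) -> n.-tuple G) : Prop :=
  pdef S set0 (fun v => [tuple v i | i < n] = F (fun i => v (n + i)%N)).

(** The coordinates are chosen from the last to the first, each one depending on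
    those already chosen. *)
Lemma fdefn_choice n P : pdef S set0 P -> exists2 F : (nat -> G) -> n.-tuple G,
  fdefn F & forall v, (exists y : n.-tuple G, P (y ++: v)) -> P (F v ++: v).
Proof.
elim: n P => [|n IH] P dP.
  exists (fun=> [tuple]) => [|v [y]]; last by rewrite tuple0.
  have : pdef S set0 (fun v => v 0 = v 0) by solve_pdef.
  by apply: pdef_ext => v; split=> // _; rewrite !tuple0.
have [|F dF FP] := IH (fun w => exists x, P (x .: w)); first by solve_pdef.
have [f df fP] := fdef_choice dP.
exists (fun v => cons_tuple (f (F v ++: v)) (F v)); last first.
  move=> v [y]; rewrite (tuple_eta y) /= => Py; apply: fP; apply: FP.
  by exists (behead_tuple y), (thead y).
have dF' : pdef S set0 (fun v => [tuple v i.+1 | i < n] = F (fun i => v (n + i).+1)).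
  by apply: (pdef_subst (s := fun i v => v i.+1) _ dF) => i; solve_tdef.
apply: pdef_ext (pdef_and dF' df) => v.
rewrite -/(fdef S f) in df *.
set u := fun i => v (n + i).+1.
have E : [tuple v i.+1 | i < n] = F u -> F u ++: u = fun i => v i.+1.
  by move=> <-; exact: (catv_mktuple n (fun i => v i.+1)).
have -> : [tuple v i | i < n.+1] = cons_tuple (v 0) [tuple v i.+1 | i < n].
  apply: eq_from_tnth => i; rewrite tnth_mktuple.
  by case: (unliftP ord0 i) => [j|] ->; rewrite ?tnthS ?tnth_mktuple ?tnth0.
split=> [[FE ->]|EF]; first by rewrite FE E.
have FE : [tuple v i.+1 | i < n] = F u.
  by apply/val_inj; have /(congr1 (fun t => behead (val t))) := EF.
by split=> //; rewrite -E //; have /(congr1 (fun t => head (v 0) (val t))) := EF.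
Qed.

Lemma complete_Skolem : has_definable_Skolem_functions S.
Proof.
move=> m n phi.
(* [phi] has its arguments first, whereas assignments carry the chosen values
   first *)
pose s (i : 'I_(m + n)) (w : nat -> G) : G :=
  match split i with inl j => w (n + j)%N | inr j => w j end.
pose P w := sat S phi [tuple s i w | i < m + n].
have dP : pdef S set0 P.
  by apply: pdef_sat => i; rewrite /s; case: split => j; solve_tdef.
have PE (x : m.-tuple G) (y : n.-tuple G) : P (y ++: pad 1%g x) <-> sat S phi (cat_tuple x y).
  rewrite /P (@tuple_split _ _ _ _ x y) // => i; rewrite /s.
    rewrite (unsplitK (inl i)) (catvE 1%g) size_tuple ltnNge leq_addr /=.
    by rewrite addKn /pad -tnth_nth.
  by rewrite (unsplitK (inr i)) (catvE 1%g) size_tuple ltn_ord -tnth_nth.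
have [F] := fdefn_choice n dP; rewrite /fdefn => dF FP.
exists (fun x => F (pad 1%g x)); last first.
  by move=> x [y /PE Py]; apply/PE/FP; exists y.
pose lft (z : (m + n).-tuple G) : m.-tuple G := [tuple tnth z (lshift n i) | i < m].
pose rgt (z : (m + n).-tuple G) : n.-tuple G := [tuple tnth z (rshift m i) | i < n].
have [theta thetaP] : exists theta : formula L (m + n), forall z,
    sat S theta z <-> rgt z = F (pad 1%g (lft z)).
  apply/(definable0P S 1%g (fun z => rgt z = F (pad 1%g (lft z)))).
  pose r i (v : nat -> G) : G :=
    if (i < n)%N then v (m + i)%N else if (i - n < m)%N then v (i - n)%N else 1%g.
  have dr : forall i, tdef S set0 (r i).
    by move=> i; rewrite /r; case: (i < n)%N; [|case: (i - n < m)%N]; solve_tdef.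
  apply: pdef_ext (pdef_subst dr dF) => v.
  have -> : [tuple r i v | i < n] = rgt [tuple v i | i < m + n].
    by apply: eq_from_tnth => i; rewrite !tnth_mktuple /r ltn_ord.
  suff -> : (fun i => r (n + i)%N v) = pad 1%g (lft [tuple v i | i < m + n]) by [].
  apply/funext => i; rewrite /r ltnNge leq_addr addKn /pad; set x := lft _.
  case: ltnP => [im|mi]; last by rewrite nth_default // size_tuple.
  by rewrite -(tnth_nth 1%g x (Ordinal im)) !tnth_mktuple.
exists theta => x y; rewrite thetaP.
have -> : lft (cat_tuple x y) = x.
  by apply: eq_from_tnth => i; rewrite tnth_mktuple tnth_lshift.
suff -> : rgt (cat_tuple x y) = y by [].
by apply: eq_from_tnth => i; rewrite tnth_mktuple tnth_rshift.
Qed.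

End Skolem.

(** * The characterization of o-minimality *)

Lemma ogroup_expansion_defines (L : language) (d : Order.disp_t)
  (G : orderedGroupType d) (S : structure L G) : defines_ogroup (ogroup_expansion S).
Proof.
split.
- apply: tdef_suml.
  have := @tdef_app _ _ (ogroup_structure G) set0 OGone (fun _ v => v 0) (fun=> tdef_var _ _ 0); exact.
- apply: (tdef_suml _ (t := fun v => (v 0%N)^-1%g)).
  have := @tdef_app _ _ (ogroup_structure G) set0 OGinv (fun i v => v i) (fun i => tdef_var _ _ i).
  by congr (tdef _ _ _); apply/funext => v; rewrite /= tnth_mktuple.
- apply: (tdef_suml _ (t := fun v => (v 0%N * v 1%N)%g)).
  have := @tdef_app _ _ (ogroup_structure G) set0 OGmul (fun i v => v i) (fun i => tdef_var _ _ i).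
  by congr (tdef _ _ _); apply/funext => v; rewrite /= !tnth_mktuple.
apply: pdef_suml.
have := @pdef_rel _ _ (ogroup_structure G) set0 tt (fun i v => v i) (fun i => tdef_var _ _ i).
by apply: pdef_ext => v; rewrite /= !tnth_mktuple.
Qed.

Lemma name_constant_defines (L : language) (d : Order.disp_t)
  (G : orderedGroupType d) (S : structure L G) c :
  defines_ogroup S -> defines_ogroup (name_constant S c).
Proof. by case=> *; split; [exact: tdef_suml..|exact: pdef_suml]. Qed.

Lemma definable1_name_constant (L : language) (M : Type) (S : structure L M) c X :
  definable1 (name_constant S c) X <-> definable1 S X.
Proof. by rewrite !(definable1P _ c) pdef_name_constant. Qed.

Theorem proposition3 (L : language) (d : Order.disp_t) (G : orderedGroupType d)
    (S : structure L G) (c : G) :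
  c <> 1%g ->
  weakly_o_minimal (ogroup_expansion S) ->
  non_valuational (ogroup_expansion S) ->
  (o_minimal (ogroup_expansion S) <->
   no_external_limits (ogroup_expansion S) /\
   has_definable_Skolem_functions (name_constant (ogroup_expansion S) c)).
Proof.
move=> c1 wom nv; have og := ogroup_expansion_defines S.
have [e ec e1] := exists_gt1 c1.
have dG := wom.1.
have nomax (x : G) : exists y, x < y by exists (x * e)%g; exact: ltg_mulr.
have nomin (x : G) : exists y, y < x by exists (x / e)%g; exact: ltg_divr.
split=> [/(o_minimal_complete dG nomax) dc|[nel sk]]; last first.
  apply: complete_o_minimal => //; apply: (Skolem_complete og dG _ nv nel sk).
  by exists e.
split; first exact: complete_no_external_limits.
have og' := name_constant_defines c og.
apply: (complete_Skolem og' dG e1).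
- have dc' : tdef (name_constant (ogroup_expansion S) c) set0 (fun=> c).
    have := @tdef_app _ _ (name_constant (ogroup_expansion S) c) set0 (inr tt) (fun _ v => v 0) (fun=> tdef_var _ _ 0); exact.
  by case: ec => ->; solve_tdef.
- split=> // X /definable1_name_constant; exact: wom.2.
by move=> X /definable1_name_constant; exact: dc.
Qed.
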